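(* Let $\{S_i\}_{i=1}^m$ be an IFS of similitudes $S_i(x)=rR_ix+d_i$ on $\mathbb R^d$ with common contraction ratio $r\in(0,1)$, with self-similar set $K$, and let $(X,\mathcal E)$, $\mathcal E=\mathcal E_v\cup\mathcal E_h$, be its augmented tree. Suppose $(X,\mathcal E)$ is simple and the corresponding incidence matrix $A$ is primitive (i.e. $A^n>0$ entrywise for some $n>0$). Then the hyperbolic boundaries $\partial(X,\mathcal E)$ and $\partial(X,\mathcal E_v)$ are Lipschitz equivalent: $\partial(X,\mathcal E)\simeq\partial(X,\mathcal E_v)$.
   Context: IFS: $S_i(x)=rR_ix+d_i$, $i=1,\dots,m$, with $0<r<1$, $R_i$ orthogonal $d\times d$ matrices, $d_i\in\mathbb R^d$; $K$ is the nonempty compact set with $K=\bigcup_iS_i(K)$. $\Sigma=\{1,\dots,m\}$, $X=\bigcup_{n\ge0}\Sigma^n$ with $\Sigma^0=\{o\}$ (empty word, the root); $S_{\mathbf u}=S_{i_1}\circ\cdots\circ S_{i_n}$ for $\mathbf u=i_1\cdots i_n$. Augmented tree: $\mathcal E_v$ is the set of (vertical) edges joining $\mathbf u$ and $\mathbf ui$ ($\mathbf u\in X$, $i\in\Sigma$); $\mathcal E_h$ (horizontal edges) is the set of pairs $(\mathbf u,\mathbf v)$, $\mathbf u\ne\mathbf v$, $\mathbf u,\mathbf v\in\Sigma^n$ for some $n$, with $S_{\mathbf u}(K)\cap S_{\mathbf v}(K)\neq\emptyset$. $\mathcal E=\mathcal E_v\cup\mathcal E_h$. Hyperbolicity: for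 a connected graph with root $o$ and graph distance $d(\cdot,\cdot)$, put $|x|=d(o,x)$, $|x\wedge y|=\frac12(|x|+|y|-d(x,y))$. The graph is hyperbolic if for some $\delta>0$, $|x\wedge y|\ge\min\{|x\wedge z|,|z\wedge y|\}-\delta$ for all $x,y,z$. For fixed $a>0$ with $e^{\delta a}-1<\sqrt2-1$, put $\rho_a(x,y)=e^{-a|x\wedge y|}$ if $x\ne y$ and $0$ if $x=y$; it is comparable up to multiplicative constants to the metric $\theta_a(x,y)=\inf\{\sum_{i=1}^n\rho_a(x_{i-1},x_i): n\ge1,\ x_0=x,\ x_n=y\}$. The hyperbolic boundary is $\partial X=\hat X\setminus X$, $\hat X$ the completion of $X$ under $\rho_a$ (equivalently $\theta_a$), with $\rho_a$ extended to it. The same $a$ is used for $(X,\mathcal E)$ and $(X,\mathcal E_v)$. A simple augmented tree (defined next) is hyperbolic, so its boundary is defined. Simple: a horizontal connected component is a maximal connected horizontal subgraph $T$ of some level $\Sigma^n$. $T\Sigma=\{\mathbf ui:\mathbf u\in T,i\in\Sigma\}$. Components $T,T'$ are equivalent if there is a bijection $g:T\cup T\Sigma\to T'\cup T'\Sigma$ (as subgraphs of $X$) such that $g,g^{-1}$ preserve vertical and horizontal edges; $[T]$ is the class of $T$. $X$ is simple if there are finitely many classes $\mathscr T_1,\dots,\mathscr T_r$. Incidence matrix: $A=[a_{ij}]_{r\times r}$, where, for any component $T$ with $[T]=\mathscr T_i$, $a_{ij}$ is the number of horizontal connected components $Z$ of $T\Sigma$ with $[Z]=\mathscr T_j$ (this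 number being independent of the choice of $T$ in the class). Lipschitz equivalence $\simeq$: existence of a bijection $\sigma$ and $C>0$ with $C^{-1}d(x,y)\le d(\sigma(x),\sigma(y))\le Cd(x,y)$ for all $x,y$. *)

(* Defs.v *)
From mathcomp Require Import all_boot all_order all_algebra.
From mathcomp Require Import all_classical all_reals all_analysis.

Set Implicit Arguments.
Unset Strict Implicit.
Unset Printing Implicit Defensive.

Import Order.TTheory GRing.Theory Num.Theory.
Import numFieldNormedType.Exports.

Local Open Scope classical_set_scope.
Local Open Scope ring_scope.

Notation word m := (seq 'I_m).

Definition root_word (m : nat) : word m := [::].

Definition ifs (R : realType) (d m : nat) (r : R)
    (Q : 'I_m -> 'M[R]_d) (b : 'I_m -> 'cV[R]_d) :
    'I_m -> 'cV[R]_d -> 'cV[R]_d :=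
  fun i x => r *: (Q i *m x) + b i.

Definition self_similar_set (R : realType) (d m : nat)
    (S : 'I_m -> 'cV[R]_d -> 'cV[R]_d) (K : set 'cV[R]_d) : Prop :=
  [/\ K !=set0, compact K & K = \bigcup_(i in [set: 'I_m]) (S i @` K)].

(* For u = i_1 ... i_n this is S_{i_1} \o ... \o S_{i_n}. *)
Definition word_map (V : Type) (m : nat) (S : 'I_m -> V -> V) (u : word m) :
    V -> V :=
  foldr (fun i f => S i \o f) id u.

Definition vedge (m : nat) : rel (word m) :=
  fun u v => [exists i, v == rcons u i] || [exists i, u == rcons v i].

Definition hedge (V : Type) (m : nat) (S : 'I_m -> V -> V) (K : set V) :
    rel (word m) :=
  fun u v => [&& u != v, size u == size v &
    `[< (word_map S u @` K) `&` (word_map S v @` K) !=set0 >]].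

Definition aug_edge (V : Type) (m : nat) (S : 'I_m -> V -> V) (K : set V) :
    rel (word m) :=
  fun u v => vedge u v || hedge S K u v.

(* Meaningful for connected graphs only: the infimum of the empty set is 0. *)
Definition gdist (R : realType) (V : Type) (E : rel V) (x y : V) : R :=
  inf [set (size p)%:R | p in [set p | path E x p /\ last x p = y]].

Definition gromov_prod (R : realType) (V : Type) (E : rel V) (o x y : V) : R :=
  (gdist R E o x + gdist R E o y - gdist R E x y) / 2.

Definition hyperbolic_with (R : realType) (V : Type) (E : rel V) (o : V)
    (delta : R) : Prop :=
  forall x y z : V,
    Num.min (gromov_prod R E o x z) (gromov_prod R E o z y) - delta
      <= gromov_prod R E o x y.

Definition hyperbolic (R : realType) (V : Type) (E : rel V) (o : V) : Prop :=
  exists2 delta : R, 0 < delta & hyperbolic_with E o delta.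

Definition visual_parameter (R : realType) (V : Type) (E : rel V) (o : V)
    (a : R) : Prop :=
  0 < a /\ exists delta : R,
    [/\ 0 < delta, hyperbolic_with E o delta &
        expR (delta * a) - 1 < Num.sqrt 2 - 1].

Definition rho (R : realType) (V : eqType) (E : rel V) (o : V) (a : R)
    (x y : V) : R :=
  if x == y then 0 else expR (- (a * gromov_prod R E o x y)).

Definition rho_cauchy (R : realType) (V : eqType) (E : rel V) (o : V) (a : R)
    (x : nat -> V) : Prop :=
  forall e : R, 0 < e -> exists N : nat, forall n k : nat,
    (N <= n)%N -> (N <= k)%N -> rho E o a (x n) (x k) < e.

Definition rho_equiv (R : realType) (V : eqType) (E : rel V) (o : V) (a : R)
    (x y : nat -> V) : Prop :=
  rho E o a (x n) (y n) @[n --> \oo] --> (0 : R).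

Definition cauchy_class (R : realType) (V : eqType) (E : rel V) (o : V) (a : R)
    (x : nat -> V) : set (nat -> V) :=
  [set y | rho_cauchy E o a y /\ rho_equiv E o a x y].

Definition rho_completion (R : realType) (V : eqType) (E : rel V) (o : V)
    (a : R) : set (set (nat -> V)) :=
  [set cauchy_class E o a x | x in rho_cauchy E o a].

(* A vertex x is identified with the class of the constant sequence x. *)
Definition hyp_boundary (R : realType) (V : eqType) (E : rel V) (o : V)
    (a : R) : set (set (nat -> V)) :=
  rho_completion E o a
    `\` [set cauchy_class E o a (fun=> x) | x in [set: V]].

(* [rho] is only a quasi-metric, so [rho (x n) (y n)] need not converge for
   Cauchy sequences x, y.  The extension used is exp (- a |xi /\ eta|), with
   |xi /\ eta| the infimum over representatives x of xi and y of eta of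
   liminf |x n /\ y n|; it agrees with [rho] on (the image of) V. *)
Definition rho_ext (R : realType) (V : eqType) (E : rel V) (o : V) (a : R)
    (xi eta : set (nat -> V)) : R :=
  sup [set limn_sup (fun n => rho E o a (x n) (y n)) | x in xi & y in eta].

Definition lipschitz_equiv (R : realType) (T U : Type)
    (A : set T) (dA : T -> T -> R) (B : set U) (dB : U -> U -> R) : Prop :=
  exists (f : T -> U) (C : R), [/\ set_bij A B f, 0 < C &
    forall x y, A x -> A y ->
      C^-1 * dA x y <= dB (f x) (f y) <= C * dA x y].

Definition level (m n : nat) : set (word m) := [set u | size u = n].

Definition offspring (m : nat) (T : set (word m)) : set (word m) :=
  [set rcons u i | u in T & i in [set: 'I_m]].

Definition hconnected (m : nat) (H : rel (word m)) (T : set (word m)) : Prop :=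
  T !=set0 /\ forall u v, T u -> T v ->
    exists p : seq (word m),
      [/\ path H u p, last u p = v & forall w, w \in p -> T w].

Definition hcomponent_in (m : nat) (H : rel (word m)) (D T : set (word m)) :
    Prop :=
  [/\ T `<=` D, hconnected H T &
      forall T', T' `<=` D -> hconnected H T' -> T `<=` T' -> T' = T].

Definition hcomponent (m : nat) (H : rel (word m)) : set (set (word m)) :=
  [set T | exists n : nat, hcomponent_in H (@level m n) T].

Definition comp_equiv (m : nat) (H : rel (word m)) (T T' : set (word m)) :
    Prop :=
  exists g : word m -> word m,
    set_bij (T `|` offspring T) (T' `|` offspring T') g /\
    forall u v, (T `|` offspring T) u -> (T `|` offspring T) v ->
      vedge (g u) (g v) = vedge u v /\ H (g u) (g v) = H u v.

Definition comp_class (m : nat) (H : rel (word m)) (T : set (word m)) :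
    set (set (word m)) :=
  [set T' | hcomponent H T' /\ comp_equiv H T T'].

Definition comp_classes (m : nat) (H : rel (word m)) :
    set (set (set (word m))) :=
  [set comp_class H T | T in hcomponent H].

Definition simple_tree (m : nat) (H : rel (word m)) : Prop :=
  finite_set (comp_classes H).

(* [cls] lists the classes T_1, ..., T_s without repetition. *)
Definition class_enum (m s : nat) (H : rel (word m))
    (cls : 'I_s -> set (set (word m))) : Prop :=
  set_bij [set: 'I_s] (comp_classes H) cls.

Definition is_incidence_matrix (m s : nat) (H : rel (word m))
    (cls : 'I_s -> set (set (word m))) (A : 'M[nat]_s) : Prop :=
  forall (i j : 'I_s) (T : set (word m)),
    hcomponent H T -> comp_class H T = cls i ->
    ([set Z | hcomponent_in H (offspring T) Z /\ comp_class H Z = cls j]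
      #= `I_(A i j))%card.

Definition primitive_mx (s : nat) (A : 'M[nat]_s) : Prop :=
  exists2 n : nat, (0 < n)%N & forall i j : 'I_s, (0 < (A ^+ n) i j)%N.

(* Main.v *)
Require Import Defs.
From mathcomp Require Import all_boot all_order all_algebra.
From mathcomp Require Import all_classical all_reals all_analysis.
From mathcomp Require Import zify ring lra.
Import Order.TTheory GRing.Theory Num.Theory.
Import numFieldNormedType.Exports.
Set Implicit Arguments.
Unset Strict Implicit.
Unset Printing Implicit Defensive.
Local Open Scope classical_set_scope.
Local Open Scope ring_scope.

(** Call two words equivalent when they lie in the same horizontal component,
    and let k(x, y) be the deepest level at which the prefixes of x and y are
    equivalent. Components form a tree, because parents of neighbours are equal
    or neighbours, and in a simple augmented tree they have at most M words.
    A path from x to y projects to the tree of components, and conversely one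
    can climb to level k(x, y), cross a component and climb down; hence the
    Gromov product of x and y lies between k(x, y) - M / 2 and k(x, y). This
    gives hyperbolicity ([narrow_hyperbolic]), and it says that the boundary is,
    up to a multiplicative constant, the space of ends of the tree of components
    with the gauge exp (- a k) ([boundary_coherent], [rho_ext_le],
    [rho_ext_ge]). The vertical tree is the case without horizontal edges, where
    components are single words and the ends are the infinite words.

    It remains to recode ends of the tree of components as infinite words while
    moving levels by a bounded amount only. A component with u words has
    u * m ^ N descendants N levels below, distributed over components of at most
    M words. Primitivity makes every component have a singleton component
    among its descendants at a fixed depth, the root being a singleton itself;
    so for N large there are enough singletons to complete a greedy packing of
    the descendants into u groups of exactly m ^ N words, each a union of
    components ([pack_classes]). Labelling the groups by the u words of the
    component yields maps theta from level (k + 1) N to level k N that are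
    constant on components, stay in the component of the prefix and have all
    fibres of size m ^ N ([redistribution]).

    By the first two properties, every end contains exactly one sequence of
    words Y with theta (Y (k + 1)) = Y k. By the third, theta has the same fibre
    sizes as the prefix map, so there are bijections psi of the levels with
    prefix (psi x) = psi (theta x) ([recoding]). Then Y |-> psi Y is a bijection
    from ends to infinite words, and the levels at which two ends separate
    before and after recoding differ by a bounded number of steps N
    ([boundaries_lipschitz_equiv]). *)

(** * Horizontal components of words *)

(** The properties of [hedge] through which the geometry of the self-similar set
    enters. *)
Record horizontal (m : nat) (H : rel (word m)) : Prop := Horizontal {
  horizontal_sym : symmetric H;
  horizontal_size : forall u v, H u v -> size u = size v;
  horizontal_parent : forall u v i j,
    H (rcons u i) (rcons v j) -> u = v \/ H u v }.

Definition hconn (m : nat) (H : rel (word m)) (u v : word m) : Prop :=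
  exists2 p, path H u p & last u p = v.

(** Components have at most [M] words; bounding duplicate-free lists avoids
    choosing a finite type of words. *)
Definition narrow (m : nat) (H : rel (word m)) (M : nat) : Prop :=
  forall (u : word m) (t : seq (word m)),
    uniq t -> (forall v, v \in t -> hconn H u v) -> (size t <= M)%N.

Definition same_at (m : nat) (H : rel (word m)) (k : nat) (x y : word m) :=
  [/\ (k <= size x)%N, (k <= size y)%N & hconn H (take k x) (take k y)].

Lemma path_rev_sym (T : Type) (E : rel T) x p : symmetric E ->
  path E x p -> exists q,
    [/\ path E (last x p) q, last (last x p) q = x & size q = size p].
Proof.
move=> Esym pp; exists (rev (belast x p)); split.
- by rewrite rev_path (eq_path (e' := E)) // => a b; rewrite Esym.
- by case: p {pp} => [|b p] //=; rewrite rev_cons last_rcons.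
- by rewrite size_rev size_belast.
Qed.

Lemma take_rconsl (T : Type) k (u : seq T) i : (k <= size u)%N ->
  take k (rcons u i) = take k u.
Proof. by move=> ku; rewrite -cats1 takel_cat. Qed.

Section Components.
Local Open Scope nat_scope.
Variables (m : nat) (H : rel (word m)).
Hypothesis horH : horizontal H.

Local Notation "u ~ v" := (hconn H u v) (at level 70).

Lemma hconn_refl u : u ~ u.
Proof. by exists [::]. Qed.

Lemma hconn_trans v u w : u ~ v -> v ~ w -> u ~ w.
Proof.
move=> [p pp <-] [q pq <-]; exists (p ++ q); last by rewrite last_cat.
by rewrite cat_path pp.
Qed.

Lemma hconn_sym u v : u ~ v -> v ~ u.
Proof.
case=> p pp <-; have [q [pq lq _]] := path_rev_sym (horizontal_sym horH) pp.
by exists q.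
Qed.

Lemma hconn_size u v : u ~ v -> size u = size v.
Proof.
case=> p + <-; elim: p u => [//|w p IH] u /= /andP[/(horizontal_size horH)-> ].
exact: IH.
Qed.

Lemma hconn_path_mem u p w : path H u p -> w \in p -> u ~ w.
Proof.
move=> + wp; case/path.splitP: wp => p1 p2.
rewrite cat_path => /andP[pp _]; exists (rcons p1 w) => //.
by rewrite last_rcons.
Qed.

Lemma hconn_parent u v i j : rcons u i ~ rcons v j -> u ~ v.
Proof.
case=> p; elim: p u i => [|a p IH] u i /=.
  by move=> _ /rcons_inj[-> _]; exact: hconn_refl.
move=> /andP[ua pa] la.
case: (lastP a) ua pa la => [/(horizontal_size horH)|w k]; first by rewrite size_rcons.
move=> /(horizontal_parent horH) uw pa la.
apply: hconn_trans (IH _ _ pa la).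
by case: uw => [->|uw]; [exact: hconn_refl | exists [:: w] => //=; rewrite uw].
Qed.

Lemma hconn_take k u v : u ~ v -> take k u ~ take k v.
Proof.
elim/last_ind: u v => [|u i IH] v uv.
  by have /esym/size0nil -> := hconn_size uv; exact: hconn_refl.
case: (lastP v) uv => [uv|v' j uv].
  by have := hconn_size uv; rewrite size_rcons.
have uv' := hconn_parent uv; have suv := hconn_size uv'.
have [ku|ku] := leqP k (size u); last by rewrite !take_oversize // size_rcons -?suv.
by rewrite !take_rconsl -?suv //; exact: IH.
Qed.

(** A shortest horizontal path visits distinct words of a single component. *)
Lemma hconn_short M u v : narrow H M -> u ~ v ->
  exists p, [/\ path H u p, last u p = v & size p <= M].
Proof.
move=> nM [p pp <-]; case/shortenP: pp => q pq uq _; exists q; split=> //.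
apply: (nM u); first by case/andP: uq.
by move=> w; exact: hconn_path_mem.
Qed.

Lemma same_at0 x y : same_at H 0 x y.
Proof. by split=> //; rewrite !take0; exact: hconn_refl. Qed.

Lemma same_at_refl k x : k <= size x -> same_at H k x x.
Proof. by split=> //; exact: hconn_refl. Qed.

Lemma same_at_sym k x y : same_at H k x y -> same_at H k y x.
Proof. by case=> ? ? ?; split=> //; exact: hconn_sym. Qed.

Lemma same_at_trans k y x z : same_at H k x y -> same_at H k y z -> same_at H k x z.
Proof. by case=> ? ? xy [? ? yz]; split=> //; exact: hconn_trans xy yz. Qed.

Lemma same_at_le k l x y : k <= l -> same_at H l x y -> same_at H k x y.
Proof.
move=> kl [lx ly xy]; split; [exact: leq_trans lx|exact: leq_trans ly|].
by have := hconn_take k xy; rewrite !take_takel.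
Qed.

Lemma same_at_hconn x y : x ~ y -> same_at H (size x) x y.
Proof.
move=> xy; have sxy := hconn_size xy.
by split; rewrite ?sxy // take_size -sxy take_size.
Qed.

Lemma max_same_at x y : exists2 k, same_at H k x y & ~ same_at H k.+1 x y.
Proof.
have ex0 : exists k, `[< same_at H k x y >] by exists 0; apply/asboolP; exact: same_at0.
have ub k : `[< same_at H k x y >] -> k <= size x by move/asboolP => [].
case: (ex_maxnP ex0 ub) => k /asboolP kxy kmax; exists k => // /asboolP /kmax.
by rewrite ltnn.
Qed.

(** ** Paths in the augmented tree *)

Definition tree_edge (u v : word m) : bool := vedge u v || H u v.

Lemma tree_edge_sym : symmetric tree_edge.
Proof.
move=> u v; rewrite /tree_edge (horizontal_sym horH); congr (_ || _).
by rewrite /vedge orbC.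
Qed.

Lemma tree_edge_rcons u i : tree_edge u (rcons u i).
Proof. by apply/orP; left; apply/orP; left; apply/existsP; exists i. Qed.

Lemma path_up k x : k <= size x -> exists p,
  [/\ path tree_edge (take k x) p, last (take k x) p = x & size p = size x - k].
Proof.
elim/last_ind: x => [|x i IH]; first by rewrite leqn0 => /eqP ->; exists [::].
rewrite size_rcons leq_eqVlt => /orP[/eqP ->|].
  by exists [::]; rewrite subnn take_oversize // size_rcons.
rewrite ltnS => kx; have [p [pp lp sp]] := IH kx.
exists (rcons p (rcons x i)); rewrite take_rconsl // rcons_path pp lp last_rcons.
by rewrite tree_edge_rcons size_rcons sp subSn.
Qed.

Lemma path_down k x : k <= size x -> exists p,
  [/\ path tree_edge x p, last x p = take k x & size p = size x - k].
Proof.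
move=> /path_up[p [pp lp <-]].
by have := path_rev_sym tree_edge_sym pp; rewrite lp.
Qed.

Lemma path_across k x y p : k <= size x -> k <= size y ->
  path H (take k x) p -> last (take k x) p = take k y ->
  exists q, [/\ path tree_edge x q, last x q = y
              & size q = (size x - k) + size p + (size y - k)].
Proof.
move=> kx ky pp lp; have [p1 [pp1 lp1 sp1]] := path_down kx.
have [p2 [pp2 lp2 sp2]] := path_up ky.
exists (p1 ++ p ++ p2); rewrite !cat_path !last_cat lp1 lp lp2 pp1 pp2 /=.
rewrite !size_cat sp1 sp2 addnA; split=> //; rewrite andbT.
by apply: sub_path pp => a b ab; rewrite /tree_edge ab orbT.
Qed.

(** Projected to the tree of components, a path stands still at each horizontal
    edge, so it cannot be shorter than the geodesic of that tree; by induction,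
    prepending an edge moves the branching level by at most one. *)
Lemma path_same_at x p : path tree_edge x p -> exists2 k,
  same_at H k x (last x p) & size x + size (last x p) <= size p + k.*2.
Proof.
elim: p x => [|w p IH] x /=.
  by move=> _; exists (size x); [exact: same_at_refl|lia].
case/andP=> /orP[/orP[]|] => [/existsP[i /eqP wx]|/existsP[i /eqP xw]|xw].
- move=> /IH[k [kw ky kwy] sk]; rewrite {w}wx in kw kwy sk ky *.
  rewrite size_rcons in kw sk.
  have [kx|kx] := leqP k (size x).
    by exists k; [split=> //; rewrite take_rconsl in kwy|lia].
  have ->: size x = k.-1 by lia.
  exists k.-1; last by lia.
  split; [lia|lia|].
  have := hconn_take k.-1 kwy; rewrite !take_takel ?leq_pred // take_rconsl //; lia.
- move=> /IH[k [kw ky kwy] sk]; rewrite {x}xw size_rcons.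
  exists k; last by lia.
  by split=> //; [rewrite size_rcons; lia|rewrite take_rconsl].
- move=> /IH[k kwy sk]; exists k; last by rewrite (horizontal_size horH xw); lia.
  apply: same_at_trans (kwy).
  have xw' : x ~ w by exists [:: w] => //=; rewrite xw.
  apply: same_at_le (same_at_hconn xw').
  by rewrite (hconn_size xw'); case: kwy.
Qed.

End Components.

(** * Gromov products in an augmented tree with narrow components *)

Section Gromov.
Variables (R : realType) (m M : nat) (H : rel (word m)).
Hypotheses (horH : horizontal H) (narH : narrow H M).

Local Notation E := (tree_edge H).
Local Notation dist := (gdist R E).
Local Notation gp := (gromov_prod R E (root_word m)).

Lemma gdist_le_path x p : path E x p -> dist x (last x p) <= (size p)%:R.
Proof.
move=> pp; apply: ge_inf; last by exists p.
by exists 0 => _ [q _ <-].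
Qed.

Lemma gdist_le_same_at k x y : same_at H k x y ->
  dist x y <= (size x)%:R + (size y)%:R - k.*2%:R + M%:R.
Proof.
case=> kx ky /(hconn_short narH)[p [pp lp sp]].
have [q [pq lq sq]] := path_across horH kx ky pp lp.
rewrite -{1}lq; apply: le_trans (gdist_le_path pq) _.
rewrite sq !natrD !natrB // -muln2 natrM.
have : (size p)%:R <= M%:R :> R by rewrite ler_nat.
by lra.
Qed.

Lemma gdist_ge_same_at k x y : ~ same_at H k.+1 x y ->
  (size x)%:R + (size y)%:R - k.*2%:R <= dist x y.
Proof.
move=> nk; apply: lb_le_inf => [|_ [p [pp lp] <-]].
  have xy0 : last (take 0 x) [::] = take 0 y by rewrite !take0.
  have [q [pq lq _]] := path_across horH (leq0n _) (leq0n _) (isT : path H _ [::]) xy0.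
  by exists (size q)%:R; exists q.
have [l] := path_same_at horH pp; rewrite lp => lxy sl.
have lk : (l <= k)%N.
  by rewrite leqNgt; apply/negP => kl; apply: nk; apply: same_at_le lxy.
rewrite lerBlDr -!natrD ler_nat; lia.
Qed.

Lemma gdist_root x : dist (root_word m) x = (size x)%:R.
Proof.
apply/eqP; rewrite eq_le; apply/andP; split.
  have [p [pp lp sp]] := @path_up _ H 0 x (leq0n _).
  rewrite take0 -/(root_word m) in pp lp; rewrite subn0 in sp.
  by rewrite -sp -{1}lp gdist_le_path.
have := @gdist_ge_same_at 0 (root_word m) x; rewrite /= add0r subr0.
by apply; case.
Qed.

Lemma gromov_prod_ge k x y : same_at H k x y -> k%:R - M%:R / 2 <= gp x y.
Proof.
move=> /gdist_le_same_at; rewrite /gromov_prod !gdist_root -muln2 natrM; lra.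
Qed.

Lemma gromov_prod_le k x y : ~ same_at H k.+1 x y -> gp x y <= k%:R.
Proof.
move=> /gdist_ge_same_at; rewrite /gromov_prod !gdist_root -muln2 natrM; lra.
Qed.

(** The branching level satisfies the ultrametric inequality exactly; only its
    comparison with the Gromov product costs a constant. *)
Lemma narrow_hyperbolic : hyperbolic R E (root_word m).
Proof.
exists (M%:R / 2 + 1); first by rewrite ltr_wpDl // divr_ge0.
move=> x y z.
have [k xz /gromov_prod_le nxz] := max_same_at H x z.
have [l zy /gromov_prod_le nzy] := max_same_at H z y.
have xy : same_at H (minn k l) x y.
  by apply: same_at_trans (same_at_le _ _ xz) (same_at_le _ _ zy) => //;
    rewrite ?geq_minl ?geq_minr.
have := gromov_prod_ge xy; rewrite -minEnat natr_min.
have : Num.min (gp x z) (gp z y) <= Num.min k%:R l%:R.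
  by rewrite le_min !ge_min nxz nzy orbT.
lra.
Qed.

Variable a : R.
Hypothesis a_gt0 : 0 < a.

Local Notation rh := (rho E (root_word m) a).

(** The distortion of [rho] caused by the width of the components. *)
Definition visual_const : R := expR (a * (M%:R / 2)).

Lemma rho_xx x : rh x x = 0.
Proof. by rewrite /rho eqxx. Qed.

Lemma rho_ge0 x y : 0 <= rh x y.
Proof. by rewrite /rho; case: ifP => // _; exact: expR_ge0. Qed.

Lemma rho_le k x y : same_at H k x y -> rh x y <= visual_const * expR (- (a * k%:R)).
Proof.
move=> /gromov_prod_ge gk; rewrite /rho; case: ifP => _.
  by rewrite mulr_ge0 // expR_ge0.
rewrite -expRD ler_expR.
have : a * (k%:R - M%:R / 2) <= a * gp x y by rewrite ler_pM2l.
by rewrite mulrBr; lra.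
Qed.

Lemma rho_ge k x y : x != y -> ~ same_at H k x y -> expR (- (a * k%:R)) <= rh x y.
Proof.
move=> /negPf xy; case: k => [|k] nxy; first by case: nxy; exact: same_at0.
rewrite /rho xy ler_expR lerN2 ler_pM2l // (le_trans (gromov_prod_le nxy)) //.
by rewrite ler_nat.
Qed.

Lemma rho_lt k x y : rh x y < expR (- (a * k%:R)) -> x = y \/ same_at H k x y.
Proof.
move=> lt; have [|xy] := eqVneq x y; [by left|right].
by apply: contrapT => /(rho_ge xy); rewrite leNgt lt.
Qed.

Lemma expR_level_small (N : nat) (e : R) : (0 < N)%N -> 0 < e ->
  exists k, visual_const * expR (- (a * (k * N)%:R)) < e.
Proof.
move=> N0 e0; set C := visual_const; have C0 : 0 < C := expR_gt0 _.
have ea0 : 0 < e * a by rewrite mulr_gt0.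
exists (Num.bound (C / (e * a))); set k := Num.bound _.
have kC : C / (e * a) < k%:R by apply: archi_boundP; rewrite divr_ge0 // ltW.
rewrite expRN ltr_pdivrMr ?expR_gt0 //.
rewrite ltr_pdivrMr // in kC; apply: lt_le_trans kC _.
rewrite mulrC -mulrA ler_pM2l //; apply: le_trans (expR_ge1Dx _).
rewrite ler_wpDl // ler_pM2l // ler_nat leq_pmulr //.
Qed.

End Gromov.

(** * Boundary points as coherent sequences of components *)

(** Ends of the tree of components, sampled at every [N]-th level: [y k] is any
    word of the component of level [k * N]. *)
Definition coherent (m : nat) (H : rel (word m)) (N : nat) (y : nat -> word m) :=
  forall k, size (y k) = (k * N)%N /\ same_at H (k * N) (y k.+1) (y k).

Definition tends (m : nat) (H : rel (word m)) (N : nat) (x y : nat -> word m) :=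
  forall k, exists n0, forall n, (n0 <= n)%N -> same_at H (k * N) (x n) (y k).

Lemma limn_sup_bounds (R : realType) (u : nat -> R) (B c e : R) (n0 : nat) :
  (forall n, 0 <= u n <= B) -> (forall n, (n0 <= n)%N -> c <= u n <= e) ->
  c <= limn_sup u <= e.
Proof.
move=> uB un.
have ub : has_ubound (range u).
  by exists B => _ [n _ <-]; case/andP: (uB n).
have lb : has_lbound (range u).
  by exists 0 => _ [n _ <-]; case/andP: (uB n).
have cs : cvgn (sups u) by apply/cvg_ex; eexists; exact: cvg_sups_inf ub lb.
have sub n : has_ubound (sdrop u n).
  by exists B => _ [k _ <-]; case/andP: (uB k).
apply/andP; split.
  apply: limr_ge => //; exists n0 => // n /= n0n.
  apply: le_trans (ub_le_sup (sub n) _); last by exists n => /=.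
  by case/andP: (un _ n0n).
apply: limr_le => //; exists n0 => // n /= n0n.
apply: ge_sup; first by exists (u n); exists n => /=.
by move=> _ [k /= nk <-]; case/andP: (un _ (leq_trans n0n nk)).
Qed.

Section Boundary.
Variables (R : realType) (m M N : nat) (H : rel (word m)).
Hypotheses (horH : horizontal H) (narH : narrow H M) (N_gt0 : (0 < N)%N).
Variable a : R.
Hypothesis a_gt0 : 0 < a.

Local Notation rh := (rho (tree_edge H) (root_word m) a).
Local Notation equiv := (rho_equiv (tree_edge H) (root_word m) a).
Local Notation cauchy := (rho_cauchy (tree_edge H) (root_word m) a).
Local Notation class := (cauchy_class (tree_edge H) (root_word m) a).
Local Notation boundary := (hyp_boundary (tree_edge H) (root_word m) a).
Local Notation C := (visual_const M a).

Lemma rho_equivP x y : equiv x y <->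
  forall k, exists n0, forall n, (n0 <= n)%N ->
    x n = y n \/ same_at H (k * N) (x n) (y n).
Proof.
split=> [/cvgrPdist_lt xy k|xy].
  have [n0 _ xyn] := xy _ (expR_gt0 (- (a * (k * N)%:R))).
  exists n0 => n /xyn /=; rewrite sub0r normrN ger0_norm ?rho_ge0 //.
  exact: (rho_lt horH a_gt0).
apply/cvgrPdist_lt => e e0; have [k ke] := expR_level_small M a_gt0 N_gt0 e0.
have [n0 xyn] := xy k; exists n0 => // n /= /xyn.
rewrite sub0r normrN ger0_norm ?rho_ge0 //.
case=> [->|/(rho_le horH narH a_gt0) s]; [by rewrite rho_xx|exact: le_lt_trans ke].
Qed.

Lemma rho_cauchyP x : cauchy x <->
  forall k, exists n0, forall n n', (n0 <= n)%N -> (n0 <= n')%N ->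
    x n = x n' \/ same_at H (k * N) (x n) (x n').
Proof.
split=> [xc k|xc e e0].
  have [n0 xn] := xc _ (expR_gt0 (- (a * (k * N)%:R))).
  exists n0 => n n' n0n n0n'; exact: (rho_lt horH a_gt0 (xn _ _ n0n n0n')).
have [k ke] := expR_level_small M a_gt0 N_gt0 e0.
have [n0 xn] := xc k; exists n0 => n n' n0n /(xn _ _ n0n).
case=> [->|/(rho_le horH narH a_gt0) s]; [by rewrite rho_xx|exact: le_lt_trans ke].
Qed.

Lemma tends_same_at x y z w k : tends H N x y -> tends H N z w ->
  exists n0, forall n n', (n0 <= n)%N -> (n0 <= n')%N ->
    same_at H (k * N) (y k) (w k) -> same_at H (k * N) (x n) (z n').
Proof.
move=> /(_ k)[n0 xy] /(_ k)[n1 zw]; exists (maxn n0 n1) => n n'.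
rewrite !geq_max => /andP[n0n _] /andP[_ n1n'] yw.
apply: same_at_trans (xy _ n0n) _; apply: same_at_trans yw _.
exact: (same_at_sym horH (zw _ n1n')).
Qed.

Lemma coherent_refl y k : coherent H N y -> same_at H (k * N) (y k) (y k).
Proof. by case/(_ k) => sy _; apply: same_at_refl; rewrite sy. Qed.

Lemma coherent_same_at y j k : coherent H N y -> (j <= k)%N ->
  same_at H (j * N) (y k) (y j).
Proof.
move=> yc; elim: k => [|k IH].
  by rewrite leqn0 => /eqP ->; exact: coherent_refl.
rewrite leq_eqVlt => /orP[/eqP ->|]; first exact: coherent_refl.
rewrite ltnS => jk; apply: same_at_trans (IH jk).
by apply: (same_at_le horH) (yc k).2; rewrite leq_mul2r jk orbT.
Qed.

Lemma coherent_tends y : coherent H N y -> tends H N y y.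
Proof. by move=> yc k; exists k => n; exact: coherent_same_at. Qed.

Lemma tends_cauchy x y : coherent H N y -> tends H N x y -> cauchy x.
Proof.
move=> yc xy; apply/rho_cauchyP => k.
have [n0 xx] := tends_same_at k xy xy; exists n0 => n n' n0n n0n'; right.
exact: xx (coherent_refl _ yc).
Qed.

(** Equivalence of sequences reads: eventually equal or in the same component at
    each level, so everything tending to one end forms a single class. *)
Lemma tends_classE x y : coherent H N y -> tends H N x y ->
  class x = [set z | tends H N z y].
Proof.
move=> yc xy; apply/seteqP; split=> z /=.
  case=> _ /rho_equivP xz k.
  have [n0 xzn] := xz k; have [n1 xyn] := xy k.
  exists (maxn n0 n1) => n; rewrite geq_max => /andP[/xzn xzk /xyn xyk].
  case: xzk => [<- //|xzk]; apply: same_at_trans xyk.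
  exact: (same_at_sym horH).
move=> zy; split; first exact: tends_cauchy zy.
apply/rho_equivP => k; have [n0 xz] := tends_same_at k xy zy.
by exists n0 => n n0n; right; apply: xz => //; exact: coherent_refl.
Qed.

Lemma coherent_classE y : coherent H N y -> class y = [set z | tends H N z y].
Proof. by move=> yc; apply: tends_classE => //; exact: coherent_tends. Qed.

Lemma coherent_class_eq y z : coherent H N y -> coherent H N z ->
  class y = class z <-> forall k, hconn H (y k) (z k).
Proof.
move=> yc zc; split=> [yz k|yz].
  have : class y y by rewrite (coherent_classE yc); exact: coherent_tends.
  rewrite yz (coherent_classE zc) => /(_ k)[n0 yn].
  have kM : (k <= maxn n0 k)%N by rewrite leq_maxr.
  have := same_at_sym horH (coherent_same_at yc kM).
  move=> /same_at_trans /(_ (yn _ (leq_maxl n0 k)))[_ _].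
  by rewrite -(yc k).1 take_size (yc k).1 -(zc k).1 take_size.
rewrite (coherent_classE yc) (coherent_classE zc); apply/seteqP; split=> x /= xt k;
    have [n0 xn] := xt k; exists n0 => n /xn /same_at_trans; apply.
- by have := same_at_hconn horH (yz k); rewrite (yc k).1.
- by have := same_at_hconn horH (hconn_sym horH (yz k)); rewrite (zc k).1.
Qed.

Lemma coherent_boundary y : coherent H N y -> boundary (class y).
Proof.
move=> yc; split; first by exists y => //; exact: tends_cauchy (coherent_tends yc).
case=> x _ xy.
have : class y y by rewrite (coherent_classE yc); exact: coherent_tends.
rewrite -xy => -[_ /rho_equivP/(_ (size x).+1)[n0 xn]].
have big k : (k <= k * N)%N by rewrite leq_pmulr.
have [||[]] := xn (maxn n0 (size x).+1); first exact: leq_maxl.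
- move=> /(congr1 size); rewrite (yc _).1 => sx.
  have := leq_trans (leq_maxr n0 (size x).+1) (big _).
  by rewrite -sx ltnn.
- by move=> /(leq_trans (big _)); rewrite ltnn.
Qed.

(** A Cauchy sequence either is eventually constant, which the boundary excludes,
    or has prefixes that settle in one component at each level; these components
    are the end. *)
Lemma boundary_coherent xi : boundary xi ->
  exists2 y, coherent H N y & xi = class y.
Proof.
move=> [[x xc <-] nconst].
have xs k : exists n0, forall n n', (n0 <= n)%N -> (n0 <= n')%N ->
    same_at H (k * N) (x n) (x n').
  have [n0 xn] := (rho_cauchyP x).1 xc k; exists n0.
  have [[n1 n01 nx]|ne] := pselect (exists2 n, (n0 <= n)%N & x n != x n0); last first.
    exfalso; apply: nconst; exists (x n0); first exact: I.
    have xn0 n : (n0 <= n)%N -> x n = x n0.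
      by move=> n0n; apply: contrapT => /eqP ?; apply: ne; exists n.
    apply/seteqP; split=> z [zc /rho_equivP ez]; split=> //; apply/rho_equivP => l;
      have [n1 ezn] := ez l; exists (maxn n0 n1) => n;
      by rewrite geq_max => /andP[/xn0 en /ezn]; rewrite en.
  have [e|s0] := xn _ _ n01 (leqnn n0); first by rewrite e eqxx in nx.
  have base n : (n0 <= n)%N -> same_at H (k * N) (x n) (x n0).
    move=> n0n; have [->|//] := xn _ _ n0n (leqnn n0).
    by apply: same_at_refl; case: s0.
  move=> n n' /base xn1 /base xn2.
  exact: same_at_trans xn1 (same_at_sym horH xn2).
have [f fP] := choice xs.
pose y k := take (k * N) (x (f k)).
have sy k : size (y k) = (k * N)%N.
  by rewrite size_takel //; have [] := fP k _ _ (leqnn _) (leqnn _).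
have yx k : same_at H (k * N) (x (f k)) (y k).
  split; rewrite ?sy //; last by rewrite /y take_takel //; exact: hconn_refl.
  by have [] := fP k _ _ (leqnn _) (leqnn _).
have yc : coherent H N y.
  move=> k; split=> //; apply: same_at_trans (yx k).
  have kk : (k * N <= k.+1 * N)%N by rewrite leq_mul2r leqnSn orbT.
  apply: same_at_trans (same_at_sym horH (same_at_le horH kk (yx k.+1))) _.
  apply: (@same_at_trans _ _ _ (x (maxn (f k) (f k.+1)))).
    by apply: same_at_le kk _ => //; apply: fP; rewrite ?leq_maxr.
  by apply: fP; rewrite ?leq_maxl.
exists y; first exact: yc.
rewrite (coherent_classE yc); apply: tends_classE yc _ => k.
by exists (f k) => n fn; apply: same_at_trans (yx k); apply: fP.
Qed.

(** ** The extended gauge on the boundary *)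

Local Notation rx := (rho_ext (tree_edge H) (root_word m) a).

Lemma rho_le_const x y : rh x y <= C.
Proof.
have := rho_le horH narH a_gt0 (same_at0 H x y).
by rewrite mulr0 oppr0 expR0 mulr1.
Qed.

Lemma limn_sup_rho_le y z x w k : coherent H N y -> coherent H N z ->
  hconn H (y k) (z k) -> tends H N x y -> tends H N w z ->
  0 <= limn_sup (fun n => rh (x n) (w n)) <= C * expR (- (a * (k * N)%:R)).
Proof.
move=> yc zc yz xy wz; have [n0 xw] := tends_same_at k xy wz.
apply: (@limn_sup_bounds _ _ C _ _ n0) => n; first by rewrite rho_ge0 rho_le_const.
move=> n0n; rewrite rho_ge0 (rho_le horH narH a_gt0 (xw _ _ n0n n0n _)) //.
by have := same_at_hconn horH yz; rewrite (yc k).1.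
Qed.

Lemma coherent_hconn0 y z : coherent H N y -> coherent H N z ->
  hconn H (y 0%N) (z 0%N).
Proof.
move=> /(_ 0%N)[/size0nil -> _] /(_ 0%N)[/size0nil -> _]; exact: hconn_refl.
Qed.

(** All representatives of two ends eventually branch where the ends do, so the
    choices in the definition of [rho_ext] cost only [visual_const]. *)
Lemma rho_ext_le y z k : coherent H N y -> coherent H N z -> hconn H (y k) (z k) ->
  0 <= rx (class y) (class z) <= C * expR (- (a * (k * N)%:R)).
Proof.
move=> yc zc yz; rewrite /rho_ext (coherent_classE yc) (coherent_classE zc).
set S := [set _ | _ in _ & _ in _].
have Sy : S (limn_sup (fun n => rh (y n) (z n))).
  by exists y; [exact: coherent_tends|exists z; [exact: coherent_tends|]].
have Sub : ubound S (C * expR (- (a * (k * N)%:R))).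
  by move=> _ [x xy [w wz <-]]; case/andP: (limn_sup_rho_le yc zc yz xy wz).
apply/andP; split; last by apply: ge_sup => //; eexists; exact: Sy.
apply: le_trans (ub_le_sup _ Sy); last by eexists; exact: Sub.
by case/andP: (limn_sup_rho_le yc zc yz (coherent_tends yc) (coherent_tends zc)).
Qed.

Lemma rho_ext_ge y z k : coherent H N y -> coherent H N z -> ~ hconn H (y k) (z k) ->
  expR (- (a * (k * N)%:R)) <= rx (class y) (class z).
Proof.
move=> yc zc nyz.
have yz0 := coherent_hconn0 yc zc.
rewrite /rho_ext (coherent_classE yc) (coherent_classE zc).
set S := [set _ | _ in _ & _ in _].
have Sy : S (limn_sup (fun n => rh (y n) (z n))).
  by exists y; [exact: coherent_tends|exists z; [exact: coherent_tends|]].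
apply: le_trans (ub_le_sup _ Sy); last first.
  eexists => _ [x xy [w wz <-]].
  by case/andP: (limn_sup_rho_le yc zc yz0 xy wz) => _; exact.
suff /andP[] : expR (- (a * (k * N)%:R)) <= limn_sup (fun n => rh (y n) (z n)) <= C by [].
apply: (@limn_sup_bounds _ _ C _ _ k) => n; first by rewrite rho_ge0 rho_le_const.
move=> kn; rewrite rho_le_const andbT.
have nyzn : ~ same_at H (k * N) (y n) (z n).
  move=> yzn; apply: nyz.
  have := same_at_sym horH (coherent_same_at yc kn).
  move=> /same_at_trans /(_ yzn) /same_at_trans /(_ (coherent_same_at zc kn))[_ _].
  by rewrite -(yc k).1 take_size (yc k).1 -(zc k).1 take_size.
apply: (rho_ge horH a_gt0) => //; apply/eqP => yzn; apply: nyzn.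
by rewrite -yzn; apply: same_at_refl; rewrite (yc n).1 leq_mul2r kn orbT.
Qed.

Lemma rho_ext_xx y : coherent H N y -> rx (class y) (class y) = 0.
Proof.
move=> yc; apply/eqP; rewrite eq_le; apply/andP; split; last first.
  by case/andP: (rho_ext_le yc yc (hconn_refl H (y 0%N))).
apply/ler_addgt0Pl => e e0; rewrite addr0.
have [k ke] := expR_level_small M a_gt0 N_gt0 e0.
apply: le_trans (ltW ke).
by case/andP: (rho_ext_le yc yc (hconn_refl H (y k))).
Qed.

End Boundary.

(** * Packing components into bins of prescribed capacity *)

Section Packing.
Local Open Scope nat_scope.
Variables (X B : finType) (e : rel X) (b0 : B) (B0 : {set B}) (M : nat).
Hypotheses (e_refl : reflexive e) (e_sym : symmetric e) (e_trans : transitive e).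

Let cl x : {set X} := [set z | e x z]%SET.

Hypothesis cl_le : forall x, #|cl x| <= M.

Lemma class_eq x z : e x z -> cl x = cl z.
Proof.
move=> xz; apply/setP => t; rewrite !inE; apply/idP/idP; last exact: e_trans.
by apply: e_trans; rewrite e_sym.
Qed.

(** Greedy packing of the classes in [D] into the bins [B0], classes
    with several elements first. If a class fits in no bin, then less than [M] room is left in every
    bin; the total room equals the number of elements still to be placed, which
    would then be below the number of singletons among them. Once only
    singletons are left, any bin with room accepts the next one. *)
Lemma pack_classes (D : {set X}) (c : B -> nat) :
  (forall x z, e x z -> x \in D -> z \in D) ->
  \sum_(b in B0) c b = #|D| ->
  (forall x, x \in D -> 1 < #|cl x| ->
    M * #|B0| <= #|[set z in D | #|cl z| == 1]%SET|) ->
  exists f : X -> B,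
    [/\ forall x z, x \in D -> e x z -> f x = f z,
        forall x, x \in D -> f x \in B0 &
        forall b, b \in B0 -> #|[set x in D | f x == b]%SET| = c b].
Proof.
have [n] := ubnP #|D|; elim: n D c => // n IH D c Dn Dsat sumc Dsing.
have [D0|[x0 x0D]] := set_0Vmem D.
  exists (fun=> b0); split=> [//|x|b bB0]; first by rewrite D0 inE.
  have -> : [set x in D | b0 == b]%SET = finset.set0.
    by rewrite D0; apply/setP => x; rewrite !inE.
  rewrite cards0; apply/esym/eqP.
  by move/eqP: sumc; rewrite D0 cards0 sum_nat_eq0 => /forall_inP /(_ _ bB0).
(* The next class to place: a singleton only if nothing larger is left. *)
have [x xD xbig] : exists2 x, x \in D &
    forall z, z \in D -> 1 < #|cl z| -> 1 < #|cl x|.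
  have [x /andP[xD xb]|none] := pickP [pred x in D | 1 < #|cl x|].
    by exists x.
  exists x0 => // z zD zb; have := none z; by rewrite inE zD zb.
have x_cl : x \in cl x by rewrite inE.
have clD : cl x \subset D by apply/fintype.subsetP => z; rewrite inE => /Dsat; apply.
have [b bB0 bc] : exists2 b, b \in B0 & #|cl x| <= c b.
  apply/exists_inP; apply: contraT; rewrite negb_exists_in => /forall_inP nob.
  have [xb|] := boolP (1 < #|cl x|).
    suff : #|D| < #|D| by rewrite ltnn.
    rewrite -{1}sumc; apply: (@leq_ltn_trans (\sum_(b in B0) M)).
      by apply: leq_sum => b /nob; rewrite -ltnNge => /ltnW /leq_trans; apply.
    rewrite sum_nat_const mulnC; apply: leq_ltn_trans (Dsing x xD xb) _.
    apply: proper_card; apply/properP; split.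
      by apply/fintype.subsetP => z; rewrite inE => /andP[].
    by exists x => //; rewrite inE xD /= neq_ltn xb orbT.
  rewrite -leqNgt => cl1.
  have : \sum_(b in B0) c b = 0.
    apply: big1 => b /nob; rewrite -ltnNge => /leq_trans /(_ cl1).
    by case: (c b).
  by rewrite sumc => /eqP; rewrite cards_eq0 => /eqP D0; rewrite D0 inE in xD.
pose c' b' := if b' == b then c b - #|cl x| else c b'.
have cardD : #|D| = #|D :\: cl x| + #|cl x|.
  by rewrite -(cardsID (cl x) D) (finset.setIidPr clD) addnC.
have cl_gt0 : 0 < #|cl x| by apply/card_gt0P; exists x.
have [||||f [fe fB0 fc]] := IH (D :\: cl x) c'.
- by move: Dn; rewrite cardD ltnS; apply: leq_trans; rewrite -addn1 leq_add2l.
- move=> z t zt; rewrite !inE => /andP[xz zD]; rewrite (Dsat _ _ zt zD) andbT.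
  by apply: contra xz => xt; apply: e_trans xt _; rewrite e_sym.
- apply: (@addIn #|cl x|); rewrite -cardD -sumc (bigD1 b) // [RHS](bigD1 b) //=.
  rewrite /c' eqxx addnAC subnK //; congr (_ + _).
  by apply: eq_bigr => b' /andP[_ /negPf ->].
- move=> z; rewrite inE => /andP[_ zD] zb.
  apply: leq_trans (Dsing _ zD zb) _; apply: subset_leq_card.
  apply/fintype.subsetP => t; rewrite !inE => /andP[-> t1]; rewrite t1 !andbT.
  apply: contraL (xbig _ zD zb) => xt.
  by rewrite (class_eq xt) (eqP t1).
exists (fun z => if e x z then b else f z); split.
- move=> z t zD zt.
  have -> : e x t = e x z.
    by apply/idP/idP => xz; apply: e_trans xz _ => //; rewrite e_sym.
  by case: ifP => // xz; apply: fe zt; rewrite !inE xz.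
- by move=> z zD; case: ifP => // xz; apply: fB0; rewrite !inE xz.
- move=> b' b'B0; have := fc _ b'B0; rewrite /c'.
  have [-> fb|b'b <-] := eqVneq b' b.
    rewrite -(subnK bc) -fb -cardsUI; set I := (_ :&: _)%SET.
    have -> : I = finset.set0.
      by apply/setP => z; rewrite !inE; case: (e x z); rewrite ?andbF.
    rewrite cards0 addn0; apply: eq_card => z; rewrite !inE.
    have [xz|_] := boolP (e x z); last by rewrite orbF.
    by rewrite eqxx (Dsat _ _ xz xD) orbT.
  apply: eq_card => z; rewrite !inE.
  by case: (e x z) => //=; rewrite eq_sym (negPf b'b) andbF.
Qed.

End Packing.

(** Match the fibres of [p] and [q] over each point in enumeration order. *)
Lemma equifibre_bijection (X B : finType) (p q : X -> B) :
  (forall b, #|[set x | p x == b]%SET| = #|[set x | q x == b]%SET|) ->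
  exists2 g : X -> X, bijective g & forall x, q (g x) = p x.
Proof.
move=> pq; pose P b := enum [set z | p z == b]%SET.
pose Q b := enum [set z | q z == b]%SET.
pose g x := nth x (Q (p x)) (index x (P (p x))).
have xP x : x \in P (p x) by rewrite mem_enum inE.
have lt x : (index x (P (p x)) < size (Q (p x)))%N.
  by rewrite -cardE -pq cardE index_mem xP.
have qg x : q (g x) = p x.
  by apply/eqP; have := mem_nth x (lt x); rewrite mem_enum inE.
exists g => //; apply: injF_bij => x z gxz.
have pxz : p x = p z by rewrite -qg gxz qg.
have := gxz; rewrite /g (set_nth_default x z) -?pxz; last by rewrite pxz lt.
move/eqP; rewrite nth_uniq ?enum_uniq ?lt //; last by rewrite pxz lt.
move/eqP => ixz.
by rewrite -(nth_index x (xP x)) ixz pxz nth_index.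
Qed.

(** * Redistributing deep words among the words of a component *)

(** Singleton components are what completes a packing to exact capacities. *)
Definition has_singletons (m : nat) (H : rel (word m)) (p : nat) : Prop :=
  forall w : word m, exists x : word m,
    [/\ size x = (size w + p)%N, hconn H (take (size w) x) w &
        forall z, hconn H x z -> z = x].

Section Redistribution.
Local Open Scope nat_scope.
Variables (m M p q : nat) (H : rel (word m)).
Hypotheses (horH : horizontal H) (narH : narrow H M).
(* Each bin may need [M] singletons and a component gives at most [M] bins; a
   third factor [M] is lost as equivalent words share their singletons. For
   [m <= 1] every component is a singleton. *)
Hypotheses (singH : has_singletons H p) (qbig : 1 < m -> M ^ 3 <= m ^ q).

Lemma size_word_prefix (l L : nat) (lL : l <= L) (x : L.-tuple 'I_m) :
  size (take l x) == l.
Proof. by rewrite size_takel ?size_tuple. Qed.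

Definition word_prefix (l L : nat) (lL : l <= L) (x : L.-tuple 'I_m) :
  l.-tuple 'I_m := Tuple (size_word_prefix lL x).

Lemma card_prefix_fibre (l L : nat) (lL : l <= L) (y : l.-tuple 'I_m) :
  #|[set x | word_prefix lL x == y]%SET| = m ^ (L - l).
Proof.
pose cat_y (w : (L - l).-tuple 'I_m) : L.-tuple 'I_m :=
  tcast (subnKC lL) [tuple of y ++ w].
have cat_yE w : cat_y w = y ++ w :> seq _ by rewrite val_tcast.
have inj : injective cat_y.
  move=> w w' /(congr1 val); rewrite /= !cat_yE => /eqP.
  by rewrite eqseq_cat // eqxx => /eqP/val_inj.
rewrite -[m in RHS]card_ord -card_tuple -cardsT -(card_imset _ inj).
apply: eq_card => x; rewrite inE; apply/eqP/imsetP => [xy|[w _ ->]].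
  have sw : size (drop l x) == L - l by rewrite size_drop size_tuple.
  exists (Tuple sw) => //; apply/val_inj; rewrite /= cat_yE /=.
  by rewrite -xy /= cat_take_drop.
by apply/val_inj; rewrite /= cat_yE take_size_cat // size_tuple.
Qed.

Definition same_component (L : nat) : rel (L.-tuple 'I_m) :=
  fun x z => `[< hconn H x z >].

Lemma same_component_refl L : reflexive (@same_component L).
Proof. by move=> x; apply/asboolP; exact: hconn_refl. Qed.

Lemma same_component_sym L : symmetric (@same_component L).
Proof. by move=> x z; apply/asboolP/asboolP; exact: hconn_sym. Qed.

Lemma same_component_trans L : transitive (@same_component L).
Proof.
move=> z x t /asboolP xz /asboolP zt; apply/asboolP; exact: hconn_trans xz zt.
Qed.

Lemma card_narrow (u : word m) (T : finType) (A : {set T}) (f : T -> word m) :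
  injective f -> (forall x, x \in A -> hconn H u (f x)) -> #|A| <= M.
Proof.
move=> injf Au; rewrite cardE -(size_map f); apply: (narH (u := u)).
  by rewrite map_inj_uniq // enum_uniq.
by move=> v /mapP[x]; rewrite mem_enum => /Au ux ->.
Qed.

Lemma card_component L (x : L.-tuple 'I_m) :
  #|[set z | same_component x z]%SET| <= M.
Proof.
apply: (card_narrow (f := val) (u := x)); first exact: val_inj.
by move=> z; rewrite inE => /asboolP.
Qed.

(** Below each of the [m ^ q] descendants of [y] at depth [q] there is a singleton
    at depth [q + p], and one singleton serves at most [M] of them. *)
Lemma many_singletons l L (lL : l <= L) (y : l.-tuple 'I_m) : L = l + q + p ->
  1 < m ->
  M ^ 2 <= #|[set x : L.-tuple 'I_m | `[< hconn H (word_prefix lL x) y >]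
               && (#|[set z | same_component x z]%SET| == 1)]%SET|.
Proof.
move=> defL m_gt1; set S := [set x | _ & _]%SET.
have [sg sgP] := choice singH.
have sgL (w : q.-tuple 'I_m) : size (sg (y ++ w)) == L.
  by have [-> _ _] := sgP (y ++ w); rewrite size_cat !size_tuple defL.
pose g w := Tuple (sgL w).
have gS w : g w \in S.
  have [_ pre sing] := sgP (y ++ w); rewrite inE; apply/andP; split.
    apply/asboolP => /=.
    have := hconn_take horH l pre; rewrite take_takel; last first.
      by rewrite size_cat !size_tuple leq_addr.
    by rewrite take_size_cat // size_tuple.
  apply/cards1P; exists (g w); apply/setP => z; rewrite !inE.
  apply/asboolP/eqP => [/sing zg|->]; last exact: hconn_refl.
  exact: val_inj.
have fib x : #|[set w | g w == x]%SET| <= M.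
  apply: (card_narrow (f := fun w => y ++ val w) (u := take (l + q) x)).
    by move=> w w' /eqP; rewrite eqseq_cat // eqxx => /eqP/val_inj.
  move=> w; rewrite inE => /eqP <-.
  by have [_ + _] := sgP (y ++ w); rewrite size_cat !size_tuple.
have cardW : m ^ q <= #|S| * M.
  rewrite -[m in m ^ q]card_ord -card_tuple -[leqLHS]sum1_card.
    rewrite (partition_big g (mem S)) //= -sum_nat_const; apply: leq_sum => x _.
  by rewrite sum1_card; apply: leq_trans (fib x); rewrite cardsE.
have [M0|M0] := posnP M; first by rewrite M0.
rewrite -(leq_pmul2r M0) -expnSr; exact: leq_trans (qbig m_gt1) cardW.
Qed.

Lemma card_tuple_small L (A : {set L.-tuple 'I_m}) : m <= 1 -> #|A| <= 1.
Proof.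
move=> m1; apply: leq_trans (max_card _) _; rewrite card_tuple card_ord.
by have [->|L0] := posnP L; last by rewrite -(exp1n L) leq_exp2r.
Qed.

(** The bins are the words of the component of [y], each with the capacity of
    its own set of descendants, so the total capacity is the number of
    descendants of the component. *)
Lemma pack_component l L (lL : l <= L) (y : l.-tuple 'I_m) : L = l + q + p ->
  exists f : L.-tuple 'I_m -> l.-tuple 'I_m,
    [/\ forall x z : L.-tuple 'I_m,
          hconn H (word_prefix lL x) y -> hconn H x z -> f x = f z,
        forall x, hconn H (word_prefix lL x) y -> hconn H y (f x) &
        forall b : l.-tuple 'I_m, hconn H y b ->
          #|[set x | `[< hconn H (word_prefix lL x) y >] && (f x == b)]%SET|
            = m ^ (L - l)].
Proof.
move=> defL.
pose D := [set x | `[< hconn H (word_prefix lL x) y >]]%SET.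
pose B0 := [set b | same_component y b]%SET.
have inD x : reflect (hconn H (word_prefix lL x) y) (x \in D).
  by rewrite inE; exact: asboolP.
have inB0 (b : l.-tuple 'I_m) : reflect (hconn H y b) (b \in B0).
  by rewrite inE; exact: asboolP.
have [|||f [fe fB0 fc]] := @pack_classes _ _ (@same_component L) y B0 M
  (@same_component_refl L) (@same_component_sym L) (@same_component_trans L)
  (@card_component L) D (fun=> m ^ (L - l)).
- move=> x z /asboolP xz /inD xy; apply/inD.
  by apply: hconn_trans xy; apply: (hconn_take horH); exact: (hconn_sym horH).
- rewrite -[RHS]sum1_card (partition_big (word_prefix lL) (mem B0)) /=; last first.
    by move=> x /inD xy; apply/inB0; exact: hconn_sym.
  apply: eq_bigr => b /inB0 yb; rewrite -(card_prefix_fibre lL b) sum1_card.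
  apply: eq_card => x; rewrite inE; apply/eqP/idP => [xb|/andP[_ /eqP]//].
  by apply/andP; split; [apply/inD; rewrite xb; exact: hconn_sym|exact/eqP].
- move=> x xD xbig.
  have m1 : 1 < m.
    rewrite ltnNge; apply: contraL xbig => /card_tuple_small.
    by rewrite -leqNgt; apply.
  apply: leq_trans (_ : M ^ 2 <= _).
    by rewrite expnS expn1 leq_mul2l card_component orbT.
  apply: leq_trans (many_singletons lL y defL m1) _; apply: subset_leq_card.
  by apply/fintype.subsetP => z; rewrite !inE.
exists f; split.
- by move=> x z /inD xy xz; apply: fe => //; apply/asboolP.
- by move=> x /inD /fB0 /inB0.
- move=> b /inB0 /fc <-; apply: eq_card => x; rewrite !inE.
  by [].
Qed.

(** The packings are chosen for one representative of each component, so that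
    they agree for equivalent words. *)
Lemma redistribution l L (lL : l <= L) : L = l + q + p ->
  exists theta : L.-tuple 'I_m -> l.-tuple 'I_m,
    [/\ forall x, hconn H (word_prefix lL x) (theta x),
        forall x z : L.-tuple 'I_m, hconn H x z -> theta x = theta z &
        forall b, #|[set x | theta x == b]%SET| = m ^ (L - l)].
Proof.
move=> defL; have [F FP] := choice (fun y => pack_component lL y defL).
pose rep (y : l.-tuple 'I_m) := odflt y [pick z | same_component y z].
have rep_hconn (y : l.-tuple 'I_m) : hconn H y (rep y).
  rewrite /rep; case: pickP => [z /asboolP //|/(_ y)].
  by rewrite same_component_refl.
have rep_eq (y z : l.-tuple 'I_m) : hconn H y z -> rep y = rep z.
  move=> yz; rewrite /rep (@eq_pick _ _ (same_component z)); last first.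
    move=> t; apply/asboolP/asboolP; apply: hconn_trans => //.
    exact: hconn_sym.
  by case: pickP => // /(_ z); rewrite same_component_refl.
pose pre := word_prefix lL.
have pre_rep x : hconn H (pre x) (rep (pre x)) by exact: rep_hconn.
exists (fun x => F (rep (pre x)) x); split.
- move=> x; have [_ + _] := FP (rep (pre x)) => /(_ _ (pre_rep x)).
  exact: hconn_trans.
- move=> x z xz; have xz' : hconn H (pre x) (pre z) by exact: hconn_take.
  have [+ _ _] := FP (rep (pre x)) => /(_ _ _ (pre_rep x) xz) ->.
  by rewrite (rep_eq _ _ xz').
- move=> b; have [_ _ /(_ b)] := FP (rep b) => <-; last first.
    exact/(hconn_sym horH)/rep_hconn.
  apply: eq_card => x; rewrite !inE; apply/eqP/andP => [xb|[/asboolP xb /eqP <-]].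
    have [_ + _] := FP (rep (pre x)) => /(_ _ (pre_rep x)); rewrite xb => rb.
    have xb' := hconn_trans (pre_rep x) rb.
    rewrite -(rep_eq _ _ xb') xb; split=> //.
    exact/asboolP/pre_rep.
  by rewrite (rep_eq _ _ xb) -(rep_eq _ _ (rep_hconn b)).
Qed.

End Redistribution.

(** * The boundary of an augmented tree and that of its vertical tree *)

Definition no_edge (m : nat) : rel (word m) := fun _ _ => false.

Lemma no_edge_horizontal m : horizontal (@no_edge m).
Proof. by []. Qed.

Lemma hconn_no_edge m (u v : word m) : hconn (@no_edge m) u v -> u = v.
Proof. by case=> -[|w p]. Qed.

Lemma no_edge_narrow m : narrow (@no_edge m) 1.
Proof.
move=> u [|v [|w t]] //= /andP[+ _] uconn.
rewrite inE => /norP[/eqP []].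
rewrite -(hconn_no_edge (uconn v _)) ?inE ?eqxx //.
by apply: hconn_no_edge (uconn w _); rewrite !inE eqxx orbT.
Qed.

Lemma tree_edge_no_edge m : tree_edge (@no_edge m) = @vedge m.
Proof. by apply/funext => u; apply/funext => v; rewrite /tree_edge orbF. Qed.

Section BoundaryEquivalence.
Variables (R : realType) (m M N : nat) (H : rel (word m)) (a : R).
Hypotheses (horH : horizontal H) (narH : narrow H M).
Hypotheses (N_gt0 : (0 < N)%N) (a_gt0 : 0 < a).

Lemma leq_level k : (k * N <= k.+1 * N)%N.
Proof. by rewrite leq_mul2r leqnSn orbT. Qed.

Local Notation T k := ((k * N)%N.-tuple 'I_m).

Variable theta : forall k, T k.+1 -> T k.
Hypothesis theta_near : forall k (x : T k.+1),
  hconn H (word_prefix (leq_level k) x) (theta x).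
Hypothesis theta_hconn : forall k (x z : T k.+1), hconn H x z -> theta x = theta z.
Hypothesis theta_fibre : forall k (b : T k),
  #|[set x | theta x == b]%SET| = (m ^ (k.+1 * N - k * N))%N.

(** The bijections [psi] carry the inverse system of the maps [theta] to that of
    the prefix maps, whose limit is the space of infinite words. *)
Lemma recoding : exists psi : forall k, T k -> T k,
  (forall k, bijective (@psi k)) /\
  forall k (x : T k.+1), word_prefix (leq_level k) (psi k.+1 x) = psi k (theta x).
Proof.
have step k (g : {g : T k -> T k | bijective g}) :
    {g' : {g' : T k.+1 -> T k.+1 | bijective g'} |
      forall x, word_prefix (leq_level k) (sval g' x) = sval g (theta x)}.
  case: g => g bijg; apply: cid.
  have [b|g' bijg' gg'] := @equifibre_bijection _ _
      (g \o @theta k) (word_prefix (leq_level k)).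
    rewrite card_prefix_fibre; case: bijg => gi gK giK.
    rewrite -(theta_fibre (gi b)); apply: eq_card => x; rewrite !inE /=.
    by rewrite (can2_eq gK giK).
  by exists (exist _ g' bijg').
have bij0 : bijective (@id (T 0)) by exists id.
pose psi := nat_rect (fun k => {g : T k -> T k | bijective g}) (exist _ _ bij0)
  (fun k g => sval (step k g)).
exists (fun k => sval (psi k)); split=> [k|k x]; first by case: (psi k).
exact: (svalP (step k (psi k))).
Qed.

(** The canonical representatives of ends: equal at level [k] as soon as they are
    equivalent at level [k + 1]. *)
Definition thread (Y : forall k, T k) := forall k, theta (Y k.+1) = Y k.

Lemma take_level k (y : T k) : take (k * N) y = y.
Proof. by rewrite take_oversize // size_tuple. Qed.

Lemma thread_coherent Y : thread Y -> coherent H N (fun k => Y k).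
Proof.
move=> tY k; split; first by rewrite size_tuple.
have := theta_near (Y k.+1); rewrite tY => YY.
split; rewrite ?size_tuple ?leq_level //.
by rewrite take_level.
Qed.

Lemma thread_hconn Y Y' k : thread Y -> thread Y' ->
  hconn H (Y k.+1) (Y' k.+1) -> Y k = Y' k.
Proof. by move=> tY tY' /theta_hconn; rewrite tY tY'. Qed.

Local Notation classH := (cauchy_class (tree_edge H) (root_word m) a).
Local Notation classV := (cauchy_class (tree_edge (@no_edge m)) (root_word m) a).
Local Notation boundaryH := (hyp_boundary (tree_edge H) (root_word m) a).
Local Notation boundaryV := (hyp_boundary (tree_edge (@no_edge m)) (root_word m) a).
Local Notation rhoH := (rho_ext (tree_edge H) (root_word m) a).
Local Notation rhoV := (rho_ext (tree_edge (@no_edge m)) (root_word m) a).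

(** Applying [theta] to any representative of an end one step below gives a
    thread, since [theta] does not depend on the representative. *)
Lemma boundary_thread xi : boundaryH xi ->
  exists2 Y, thread Y & xi = classH (fun k => Y k).
Proof.
move=> /(boundary_coherent horH narH N_gt0 a_gt0)[y yc ->].
have sy k : size (y k) == (k * N)%N by have [->] := yc k.
pose y' k : T k := Tuple (sy k).
pose Y k : T k := theta (y' k.+1).
have near k : hconn H (y k) (Y k).
  apply: hconn_trans (theta_near (y' k.+1)) => /=.
  have [_ [_ _]] := yc k; rewrite (take_level (y' k)).
  exact: hconn_sym.
have tY : thread Y.
  by move=> k; apply: theta_hconn => /=; exact: (hconn_sym horH).
exists Y; first exact: tY.
exact/(coherent_class_eq horH narH N_gt0 a_gt0 yc (thread_coherent tY)).
Qed.

(** If two threads first differ at step [j + 1], then both the ends and their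
    recodings agree at step [j] and are separated at step [j + 2]; the factor
    [expR (a * N *+ 2)] in the constant accounts for these two steps. *)
Lemma boundaries_lipschitz_equiv : lipschitz_equiv boundaryH rhoH boundaryV rhoV.
Proof.
have [psi [psi_bij psi_prefix]] := recoding.
have horV := @no_edge_horizontal m; have narV := @no_edge_narrow m.
pose Z (Y : forall k, T k) k : word m := psi k (Y k).
have Zc Y : thread Y -> coherent (@no_edge m) N (Z Y).
  move=> tY k; split; first by rewrite size_tuple.
  have := psi_prefix _ (Y k.+1); rewrite tY => /(congr1 val) /= pY.
  split; rewrite ?size_tuple ?leq_level // pY /Z.
  rewrite take_level; exact: hconn_refl.
have thread_eq Y Y' k : thread Y -> thread Y' -> Y k.+1 = Y' k.+1 -> Y k = Y' k.
  by move=> tY tY' YY'; rewrite -tY -tY' YY'.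
have Z_inj Y Y' k : Z Y k = Z Y' k -> Y k = Y' k.
  by move=> /val_inj; exact: (bij_inj (psi_bij k)).
have classH_eq Y Y' : thread Y -> thread Y' ->
    classH (fun k => Y k) = classH (fun k => Y' k) -> forall k, Y k = Y' k.
  move=> tY tY' /(coherent_class_eq horH narH N_gt0 a_gt0
    (thread_coherent tY) (thread_coherent tY')) YY' k.
  exact: thread_hconn (YY' k.+1).
have f_ex xi : exists eta, boundaryH xi ->
    exists Y, [/\ thread Y, xi = classH (fun k => Y k) & eta = classV (Z Y)].
  have [xiB|nxi] := pselect (boundaryH xi); last by exists set0.
  by have [Y tY ->] := boundary_thread xiB; exists (classV (Z Y)) => _; exists Y.
have [f fP] := choice f_ex.
pose K : R := (visual_const M a + visual_const 1 a) * expR (a * N%:R *+ 2).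
have vc0 M' : 0 < visual_const M' a by exact: expR_gt0.
have K0 : 0 < K by rewrite mulr_gt0 ?expR_gt0 // addr_gt0.
exists f, K; split=> //.
- split.
  + move=> xi /fP[Y [tY _ ->]].
    exact: (coherent_boundary horV narV N_gt0 a_gt0 (Zc _ tY)).
  + move=> xi xi' /set_mem /fP[Y [tY -> ->]] /set_mem /fP[Y' [tY' -> ->]].
    move=> /(coherent_class_eq horV narV N_gt0 a_gt0 (Zc _ tY) (Zc _ tY')) ZZ.
    apply/(coherent_class_eq horH narH N_gt0 a_gt0
      (thread_coherent tY) (thread_coherent tY')) => k.
    by rewrite (Z_inj _ _ _ (hconn_no_edge (ZZ k))); exact: hconn_refl.
  + move=> eta /(boundary_coherent horV narV N_gt0 a_gt0)[z zc ->].
    have sz k : size (z k) == (k * N)%N by have [->] := zc k.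
    pose z' k : T k := Tuple (sz k).
    have inv k : exists g, cancel g (psi k) by case: (psi_bij k) => g _ gK; exists g.
    pose Y k : T k := sval (cid (inv k)) (z' k).
    have psiY k : psi k (Y k) = z' k by exact: (svalP (cid (inv k))).
    have tY : thread Y.
      move=> k; apply: (bij_inj (psi_bij k)); rewrite -psi_prefix !psiY.
      apply/val_inj => /=; have [_ [_ _ /hconn_no_edge]] := zc k.
      by rewrite (take_level (z' k)).
    have YB := coherent_boundary horH narH N_gt0 a_gt0 (thread_coherent tY).
    exists (classH (fun k => Y k)) => //.
    have [Y' [tY' YY' ->]] := fP _ YB.
    congr (cauchy_class _ _ _ _); apply/funext => k.
    by rewrite /Z -(classH_eq _ _ tY tY' YY') psiY.
- move=> xi xi' /fP[Y [tY -> ->]] /fP[Y' [tY' -> ->]].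
  have Yc := thread_coherent tY; have Yc' := thread_coherent tY'.
  have [YY'|] := pselect (forall k, Y k = Y' k).
    have -> : (fun k => Y k : word m) = (fun k => Y' k : word m).
      by apply/funext => k; rewrite YY'.
    have -> : Z Y = Z Y' by apply/funext => k; rewrite /Z YY'.
    rewrite (rho_ext_xx horH narH N_gt0 a_gt0 Yc').
    by rewrite (rho_ext_xx horV narV N_gt0 a_gt0 (Zc _ tY')) !mulr0 lexx.
  move=> /existsNP nYY'.
  have ex_neq : exists k, Y k != Y' k by have [k /eqP ?] := nYY'; exists k.
  case: (ex_minnP ex_neq) => -[|j] neqj minj.
    have nil0 (y : T 0) : val y = [::] by apply: size0nil; rewrite size_tuple.
    by move/eqP: neqj => []; apply/val_inj; rewrite !nil0.
  have eqj : Y j = Y' j by apply: contrapT => /eqP/minj; rewrite ltnn.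
  have nH : ~ hconn H (Y j.+2) (Y' j.+2).
    by move=> /(thread_hconn tY tY') /eqP; apply/negP.
  have nV : ~ hconn (@no_edge m) (Z Y j.+2) (Z Y' j.+2).
    move=> /hconn_no_edge /Z_inj /(thread_eq _ _ _ tY tY') /eqP; exact/negP.
  have lowH := rho_ext_ge horH narH N_gt0 a_gt0 Yc Yc' nH.
  have lowV := rho_ext_ge horV narV N_gt0 a_gt0 (Zc _ tY) (Zc _ tY') nV.
  have eqH : hconn H (Y j) (Y' j) by rewrite eqj; exact: hconn_refl.
  have eqV : hconn (@no_edge m) (Z Y j) (Z Y' j) by rewrite /Z eqj; exact: hconn_refl.
  have /andP[_ upH] := rho_ext_le horH narH N_gt0 a_gt0 Yc Yc' eqH.
  have /andP[_ upV] := rho_ext_le horV narV N_gt0 a_gt0 (Zc _ tY) (Zc _ tY') eqV.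
  have shift : expR (- (a * (j * N)%:R)) =
      expR (a * N%:R *+ 2) * expR (- (a * (j.+2 * N)%:R)).
    by rewrite -expRD; congr expR; rewrite !natrM -[j.+2]addn2 natrD; ring.
  move: lowH upH lowV upV.
  move: (rhoH _ _) (rhoV _ _) => DH DV lowH upH lowV upV.
  rewrite ler_pdivrMl //; apply/andP; split.
    apply: (le_trans upH); rewrite shift mulrA.
    apply: (ler_pM _ _ _ lowV); rewrite ?mulr_ge0 ?expR_ge0 //.
    by rewrite ler_pM2r ?expR_gt0 // lerDl ltW.
  apply: (le_trans upV); rewrite shift mulrA.
  apply: (ler_pM _ _ _ lowH); rewrite ?mulr_ge0 ?expR_ge0 //.
  by rewrite ler_pM2r ?expR_gt0 // lerDr ltW.
Qed.

End BoundaryEquivalence.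

(** * Components of a simple augmented tree *)

Section SimpleTree.
Variables (m : nat) (H : rel (word m)).
Hypothesis horH : horizontal H.

Definition component (u : word m) : set (word m) := [set v | hconn H u v].

Lemma component_connected u : hconnected H (component u).
Proof.
split; first by exists u; exact: hconn_refl.
move=> v w uv uw; have [p pp lp] := hconn_trans (hconn_sym horH uv) uw.
exists p; split=> // t tp; exact: hconn_trans uv (hconn_path_mem pp tp).
Qed.

Lemma connected_sub_component T u : hconnected H T -> T u -> T `<=` component u.
Proof. by move=> [_ Tc] Tu v Tv; have [p [pp lp _]] := Tc _ _ Tu Tv; exists p. Qed.

Lemma component_hcomponent_in D u : component u `<=` D ->
  hcomponent_in H D (component u).
Proof.
move=> uD; split=> //; first exact: component_connected.
move=> T TD Tc uT; apply/seteqP; split=> //.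
by apply: connected_sub_component => //; apply: uT; exact: hconn_refl.
Qed.

Lemma hcomponent_inE D T u : hcomponent_in H D T -> T u -> component u `<=` D ->
  T = component u.
Proof.
move=> [TD Tc Tmax] Tu uD; apply/esym; apply: Tmax => //.
  exact: component_connected.
exact: connected_sub_component.
Qed.

Lemma component_level u : component u `<=` level (size u).
Proof. by move=> v /(hconn_size horH). Qed.

Lemma component_hcomponent u : hcomponent H (component u).
Proof.
exists (size u); apply: component_hcomponent_in; exact: component_level.
Qed.

Lemma hcomponentE T : hcomponent H T -> exists u, T = component u.
Proof.
case=> n Tn; case: (Tn) => TD [[u Tu] _] _; exists u.
by apply: (hcomponent_inE Tn Tu); rewrite -(TD _ Tu); exact: component_level.
Qed.

Lemma offspring_component u v i : hconn H u v ->
  component (rcons v i) `<=` offspring (component u).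
Proof.
move=> uv w; case: (lastP w) => [/(hconn_size horH)|w' j /(hconn_parent horH) vw].
  by rewrite size_rcons.
by exists w'; [exact: hconn_trans vw|exists j].
Qed.

Lemma comp_equiv_refl T : comp_equiv H T T.
Proof. by exists id; split=> //; split=> [x|x y|x] //; exists x. Qed.

Lemma comp_class_equiv u v :
  comp_class H (component u) = comp_class H (component v) ->
  comp_equiv H (component u) (component v).
Proof.
move=> uv; suff : comp_class H (component u) (component v) by case.
rewrite uv; split; [exact: component_hcomponent|exact: comp_equiv_refl].
Qed.

Lemma finite_short_words n : finite_set [set w : word m | (size w <= n)%N].
Proof.
elim: n => [|n IH].
  apply: sub_finite_set (finite_set1 [::]) => w /=.
  by rewrite leqn0 => /eqP/size0nil.
have : finite_set [set rcons p.1 p.2 | p in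
    [set w : word m | (size w <= n)%N] `*` [set: 'I_m]].
  by apply: finite_image; apply: finite_setX => //; exact: finite_finset.
move=> fin; apply: sub_finite_set (_ : finite_set ([set [::]] `|` _)); last first.
  by rewrite finite_setU; split; [exact: finite_set1|exact: fin].
move=> w /=; case: (lastP w) => [|w' i]; first by left.
by rewrite size_rcons => sw; right; exists (w', i).
Qed.

(** Equivalent components have, together with their offspring, equally many
    words, so one representative
    of each of the finitely many classes bounds all components. *)
Lemma simple_narrow s (cls : 'I_s -> set (set (word m))) :
  class_enum H cls -> exists M, narrow H M.
Proof.
move=> [cls_fun _ cls_surj].
have cls_rep i : exists u, cls i = comp_class H (component u).
  by have [T /hcomponentE[u ->] <-] := cls_fun i I; exists u.
have [rep repE] := choice cls_rep.
have fin i : exists t : seq (word m),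
    component (rep i) `|` offspring (component (rep i)) = [set` t].
  apply/finite_seqP; apply: sub_finite_set (finite_short_words (size (rep i)).+1).
  move=> w /= [/component_level <-//|[v /component_level <- [j _ <-]]].
  by rewrite size_rcons.
have [lst lstE] := choice fin.
exists (\max_i size (lst i))%N => u t tu tc.
have [i _ iu] := cls_surj _ (imageP (comp_class H) (component_hcomponent u)).
have [g [[_ _ g_surj] _]] : comp_equiv H (component (rep i)) (component u).
  by apply: comp_class_equiv; rewrite -repE.
apply: leq_trans (leq_bigmax i); rewrite -[size (lst i)](size_map g).
apply: uniq_leq_size => // v /tc uv.
have [w] := g_surj v (or_introl uv).
by rewrite lstE => wl <-; apply: map_f.
Qed.

(** The vertical graph on a component and its offspring is a disjoint union of
    stars, one for each word of the component. For the root it is a single star,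
    and being a star is invariant under equivalence. *)
Lemma comp_equiv_root u : comp_equiv H (component [::]) (component u) ->
  forall v, hconn H u v -> v = u.
Proof.
rewrite /comp_equiv; set A := component [::] `|` _; set B := component u `|` _.
move=> [g [[g_fun _ g_surj] g_edge]] v uv.
have rootE w : component [::] w -> w = [::].
  by move=> /(hconn_size horH) /esym /size0nil.
have A0 : A [::] by left; exact: hconn_refl.
have centre w : B w -> w = g [::] \/ vedge (g [::]) w.
  move=> /g_surj[x Ax <-]; case: (Ax) => [/rootE ->|]; first by left.
  move=> [x0 /rootE -> [i _ xi]]; right.
  have [-> _] := g_edge _ _ A0 Ax; rewrite /vedge; apply/orP; left.
  by apply/existsP; exists i; rewrite -xi.
have sv w : hconn H u w -> size w = size u by move/(hconn_size horH).
have parent w : hconn H u w -> w = g [::] \/ exists i, g [::] = rcons w i.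
  move=> uw; case: (centre w (or_introl uw)) => [|/orP[]/existsP[i /eqP]]; [by left| |].
    move=> wi; case: (g_fun _ A0) => [/sv sg|[t ut [j _ gj]]].
      by have := sv _ uw; rewrite wi size_rcons sg; lia.
    by have := sv _ uw; rewrite wi -gj !size_rcons (sv _ ut); lia.
  by move=> gi; right; exists i.
have suv := sv _ uv.
case: (parent u (hconn_refl H u)) (parent v uv) => [ug|[i gi]] [vg|[j gj]].
- by rewrite vg.
- by move: suv; rewrite ug gj size_rcons; lia.
- by move: suv; rewrite vg gi size_rcons; lia.
- by move: gj; rewrite gi => /rcons_inj[].
Qed.

(** A positive entry of [A ^+ p] gives, below any component of the row class, a
    component of the column class at depth [p]; take the column of the root. *)
Lemma primitive_has_singletons s (cls : 'I_s -> set (set (word m)))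
    (A : 'M[nat]_s) : class_enum H cls -> is_incidence_matrix H cls A ->
  primitive_mx A -> exists2 p, (0 < p)%N & has_singletons H p.
Proof.
move=> [cls_fun _ cls_surj] incA [p p0 Ap].
have cls_of u : exists i, cls i = comp_class H (component u).
  have [i _ iu] := cls_surj _ (imageP (comp_class H) (component_hcomponent u)).
  by exists i.
have descend n : forall i j u, cls i = comp_class H (component u) ->
    (0 < (A ^+ n) i j)%N -> exists x, [/\ size x = (size u + n)%N,
      hconn H (take (size u) x) u & cls j = comp_class H (component x)].
  elim: n => [|n IH] i j u iu.
    rewrite expr0 mxE; case: eqVneq => [<- _|//].
    by exists u; rewrite addn0 take_size; split=> //; exact: hconn_refl.
  rewrite exprS; set P := A ^+ n.
  have -> : (A * P) i j = \sum_k A i k * P k j by exact: mxE.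
  move=> sum_gt0.
  have /existsP[k Ak] : [exists k, A i k * P k j != 0].
    apply: contraLR sum_gt0; rewrite negb_exists => /forallP all0.
    by rewrite big1 // => k _; apply/eqP; rewrite -[_ == _]negbK.
  have Aik : (0 < A i k)%N.
    by rewrite lt0n; apply: contraNneq Ak => ->; rewrite mul0r.
  have Pkj : (0 < P k j)%N.
    by rewrite lt0n; apply: contraNneq Ak => ->; rewrite mulr0.
  have := incA i k _ (component_hcomponent u) (esym iu).
  set Zs := [set Z | _] => Zcard.
  have [Z [Zin Zk]] : Zs !=set0.
    apply/set0P; apply: contraTneq Aik => Z0.
    move: Zcard; rewrite Z0 card_eq_sym card_eq0 => /eqP I0.
    rewrite lt0n negbK -leqn0 leqNgt; apply/negP => A0.
    by have : `I_(A i k) 0%N by []; rewrite I0.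
  case: (Zin) => Zoff [[z Zz] _] _.
  have [v uv [l _ vz]] := Zoff _ Zz; subst z.
  have Zv := hcomponent_inE Zin Zz (offspring_component (i := l) uv).
  have [x [sx xz xj]] := IH k j (rcons v l) (etrans (esym Zk) (congr1 _ Zv)) Pkj.
  exists x; split=> //; first by rewrite sx size_rcons (hconn_size horH uv) addSnnS.
  have := hconn_take horH (size u) xz.
  rewrite take_takel ?size_rcons (hconn_size horH uv) ?leqnSn // take_rconsl //.
  rewrite take_size => /hconn_trans; apply; exact: hconn_sym.
have [i0 root0] := cls_of [::].
exists p => // w; have [i iw] := cls_of w.
have [x [sx xw xj]] := descend p i i0 w iw (Ap i i0).
exists x; split=> //; apply: comp_equiv_root; apply: comp_class_equiv.
by rewrite -root0.
Qed.

End SimpleTree.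

Lemma word_map_rcons (V : Type) (m : nat) (S : 'I_m -> V -> V) u i :
  word_map S (rcons u i) = word_map S u \o S i.
Proof. by elim: u => //= j u IH; rewrite -/(word_map S _) IH. Qed.

Lemma hedge_horizontal (V : Type) (m : nat) (S : 'I_m -> V -> V) (K : set V) :
  (forall i, S i @` K `<=` K) -> horizontal (hedge S K).
Proof.
move=> SK; split.
- by move=> u v; rewrite /hedge eq_sym [size u == _]eq_sym setIC.
- by move=> u v /and3P[_ /eqP].
- move=> u v i j /and3P[_]; rewrite !size_rcons eqSS => suv /asboolP[x].
  rewrite !word_map_rcons => -[[y Ky <-] [z Kz zy]].
  have [->|uv] := eqVneq u v; [by left|right]; rewrite /hedge uv suv /=.
  apply/asboolP; exists (word_map S u (S i y)); split.
    by exists (S i y) => //; apply: SK; exists y.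
  by exists (S j z) => //; apply: SK; exists z.
Qed.

(** * Lipschitz equivalence of the boundaries *)

(** The step [N] is [q + p] with [q = M ^ 3], which suffices as
    [n < m ^ n] for [m > 1]. *)
Lemma narrow_boundaries_lipschitz_equiv (R : realType) (m M p : nat)
    (H : rel (word m)) (a : R) :
  horizontal H -> narrow H M -> (0 < p)%N -> has_singletons H p -> 0 < a ->
  lipschitz_equiv
    (hyp_boundary (tree_edge H) (root_word m) a)
    (rho_ext (tree_edge H) (root_word m) a)
    (hyp_boundary (@vedge m) (root_word m) a)
    (rho_ext (@vedge m) (root_word m) a).
Proof.
move=> horH narH p_gt0 singH a_gt0; pose q := (M ^ 3)%N.
have qbig : (1 < m)%N -> (M ^ 3 <= m ^ q)%N by move=> m1; rewrite ltnW // ltn_expl.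
have N_gt0 : (0 < q + p)%N by rewrite addn_gt0 p_gt0 orbT.
have levelE k : (k.+1 * (q + p))%N = (k * (q + p) + q + p)%N.
  by rewrite mulSn addnC addnA.
pose red k := cid (redistribution horH narH singH qbig
  (leq_level (q + p) k) (levelE k)).
rewrite -tree_edge_no_edge.
apply: (@boundaries_lipschitz_equiv _ _ M (q + p) H a horH narH N_gt0 a_gt0
  (fun k => sval (red k))) => k; by have [] := svalP (red k).
Qed.

Theorem theorem1p1 (R : realType) (d m : nat) (r : R)
    (Q : 'I_m -> 'M[R]_d) (b : 'I_m -> 'cV[R]_d) (K : set 'cV[R]_d)
    (s : nat) (cls : 'I_s -> set (set (word m))) (A : 'M[nat]_s) :
  0 < r < 1 ->
  (forall i, (Q i)^T *m Q i = 1%:M) ->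
  self_similar_set (ifs r Q b) K ->
  simple_tree (hedge (ifs r Q b) K) ->
  class_enum (hedge (ifs r Q b) K) cls ->
  is_incidence_matrix (hedge (ifs r Q b) K) cls A ->
  primitive_mx A ->
  hyperbolic R (aug_edge (ifs r Q b) K) (root_word m) /\
  forall a : R,
    visual_parameter (aug_edge (ifs r Q b) K) (root_word m) a ->
    lipschitz_equiv
      (hyp_boundary (aug_edge (ifs r Q b) K) (root_word m) a)
      (rho_ext (aug_edge (ifs r Q b) K) (root_word m) a)
      (hyp_boundary (@vedge m) (root_word m) a)
      (rho_ext (@vedge m) (root_word m) a).
Proof.
move=> _ _ [_ _ KE] _ enum_cls incA primA.
have horH : horizontal (hedge (ifs r Q b) K).
  by apply: hedge_horizontal => i x Kx; rewrite KE; exists i.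
have [M narH] := simple_narrow horH enum_cls.
have [p p_gt0 singH] := primitive_has_singletons horH enum_cls incA primA.
split; first exact: (narrow_hyperbolic R horH narH).
move=> a [a_gt0 _].
exact: (narrow_boundaries_lipschitz_equiv horH narH p_gt0 singH a_gt0).
Qed.
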